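(* Let $(V,\cdot,\langle\cdot,\cdot\rangle)$ be a co-compact non asymmetric Courant algebroid on a connected smooth manifold $M$. If the cocycle $\langle\cdot,\cdot\rangle$ is definite, then its cohomology class in $H^2(\Gamma(V),F(M))$ does not vanish.
   Context: $M$ is a connected smooth manifold, $F(M)=C^\infty(M,\mathbb R)$, $V$ is a smooth real vector bundle on $M$, and $\Gamma(V)$ is its space of smooth sections. A Koszul-Vinberg algebra is an algebra with $a(bc)-(ab)c=b(ac)-(ba)c$ for all elements $a,b,c$. A non asymmetric Courant algebroid written as a triple $(V,\cdot,\langle\cdot,\cdot\rangle)$ (i.e. with anchor $\rho=0$ and 1-cocycle $D=0$) is a Koszul-Vinberg algebra bundle with an invariant form: $\Gamma(V)$ carries an $F(M)$-bilinear multiplication $(s,s')\mapsto ss'$ making it a Koszul-Vinberg algebra, and $\langle\cdot,\cdot\rangle$ is a (smooth, fiberwise) non degenerate symmetric bilinear form on $V$ with $\langle ss',s''\rangle+\langle s',ss''\rangle=0$ for all $s,s',s''\in\Gamma(V)$. Each fiber $V_x$ is a real Koszul-Vinberg algebra with $s(x)\cdot s'(x)=(ss')(x)$. For $x\in M$, $G_x$ denotes the connected and simply connected Lie group whose Lie algebra is $V_x$ with bracket $[s(x),s'(x)]=(ss')(x)-(s's)(x)$. The algebroid is called co-compact if each $G_x$ contains a co-compact lattice $\Lambda_x$ (a discrete subgroup with compact quotient $\Lambda_x\backslash G_x$). Koszul-Vinberg cohomology with trivial coefficients: $C^k(\Gamma(V),F(M))$ is the space of $F(M)$-multilinear maps $\Gamma(V)^k\to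 F(M)$, with $F(M)$ regarded as a trivial $\Gamma(V)$-module. For $\Theta\in C^1$, $\delta\Theta(s,s')=\Theta(ss')$; for $\Theta\in C^2$, $\delta\Theta(s,s',s'')=\Theta(ss',s'')+\Theta(s',ss'')-\Theta(s's,s'')-\Theta(s,s's'')$. $H^2(\Gamma(V),F(M))$ is the space of 2-cocycles modulo $\delta C^1(\Gamma(V),F(M))$. The form $\langle\cdot,\cdot\rangle$ is a 2-cocycle. Definite means definite on every fiber.
   Formalization: The bundle V is assumed to have positive rank: on the rank-0 bundle the zero form is vacuously definite and its cohomology class is zero, so the claim fails there. *)

(* Defs.v *)
From HB Require Import structures.
From mathcomp Require Import all_boot all_order all_algebra.
From mathcomp Require Import all_classical all_reals all_analysis.
From mathcomp Require Import generic_quotient ring_quotient.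
From mathcomp Require Import ring.
Import numFieldNormedType.Exports.
Import Order.TTheory GRing.Theory Num.Theory.

Set Implicit Arguments.
Unset Strict Implicit.
Unset Printing Implicit Defensive.

Local Open Scope classical_set_scope.
Local Open Scope ring_scope.

Section smooth_on.
Context {R : realType} {E W : normedModType R}.
Implicit Types (U : set E) (f g : E -> W).

(* On an open set of a finite-dimensional space, f is C^(k+1) iff it is
   continuous and all its directional derivatives exist and are C^k. *)
Fixpoint Ck (k : nat) U f : Prop :=
  (forall x, U x -> {for x, continuous f}) /\
  if k is k'.+1 then
    forall v, (forall x, U x -> derivable f x v) /\ Ck k' U (fun x => 'D_v f x)
  else True.

Definition smooth_on U f : Prop := forall k, Ck k U f.

Lemma Ck_continuous k U f : Ck k U f -> forall x, U x -> {for x, continuous f}.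
Proof. by case: k => [|k] []. Qed.

Lemma CkS k U f : Ck k.+1 U f -> Ck k U f.
Proof.
elim: k f => [|k IH] f [cf df]; first by split.
by split=> // v; have [dfv /IH] := df v.
Qed.

Lemma Ck_ext k U f g : open U -> (forall x, U x -> f x = g x) ->
  Ck k U f -> Ck k U g.
Proof.
move=> oU; have nearU x (p q : E -> W) : U x -> (forall x, U x -> p x = q x) ->
    \forall y \near x, p y = q y.
  by move=> Ux pq; apply: filterS pq _; exact: open_nbhs_nbhs.
have cont (p q : E -> W) : (forall x, U x -> p x = q x) ->
    (forall x, U x -> {for x, continuous p}) ->
    forall x, U x -> {for x, continuous q}.
  move=> pq cp x Ux; rewrite /prop_for /continuous_at -pq//.
  exact: cvg_trans (near_eq_cvg (nearU x p q Ux pq)) (cp x Ux).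
elim: k f g => [|k IH] f g fg [cf df]; split => //; try exact: cont fg cf.
move=> v; have [dfv Dfv] := df v; split=> [x Ux|].
- by apply: near_eq_derivable (dfv x Ux); exact: nearU.
- by apply: IH Dfv => x Ux; apply: near_eq_derive; exact: nearU.
Qed.

Lemma Ck_cst k U (w : W) : open U -> Ck k U (fun=> w).
Proof.
move=> oU; elim: k w => [|k IH] w; split => //.
- by move=> x _; exact: cst_continuous.
- by move=> x _; exact: cst_continuous.
- move=> v; split=> [x _|]; first exact: derivable_cst.
  by apply: Ck_ext (IH 0) => // x _; rewrite derive_cst.
Qed.

Lemma CkD k U f g : open U -> Ck k U f -> Ck k U g ->
  Ck k U (fun x => f x + g x).
Proof.
move=> oU; elim: k f g => [|k IH] f g [cf df] [cg dg]; split => //.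
- by move=> x Ux; apply: cvgD; [exact: cf|exact: cg].
- by move=> x Ux; apply: cvgD; [exact: cf|exact: cg].
- move=> v; have [dfv Dfv] := df v; have [dgv Dgv] := dg v; split.
    by move=> x Ux; apply: derivableD; [exact: dfv|exact: dgv].
  apply: Ck_ext (IH _ _ Dfv Dgv) => // x Ux.
  by rewrite deriveD//; [exact: dfv|exact: dgv].
Qed.

End smooth_on.

Section smooth_onZ.
Context {R : realType} {E W : normedModType R}.
Implicit Types (U : set E) (f : E -> R) (g : E -> W).

Lemma is_derive_scale f g x v : derivable f x v -> derivable g x v ->
  is_derive x v (fun y => f y *: g y) (f x *: 'D_v g x + 'D_v f x *: g x).
Proof.
move=> df dg.
suff L : (fun h => h^-1 *: (((fun y => f y *: g y) \o shift x) (h *: v) -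
    f x *: g x)) @ 0^' --> f x *: 'D_v g x + 'D_v f x *: g x.
  by apply: DeriveDef; [apply: cvgP L|exact: cvg_lim L].
rewrite [X in X @ _](_ : _ = fun h => f (h *: v + x) *:
    (h^-1 *: (g (h *: v + x) - g x)) +
    (h^-1 *: (f (h *: v + x) - f x)) *: g x); last first.
  apply/funext => h /=; rewrite !scalerA [f _ * _]mulrC -!scalerA -scalerDr.
  by congr (_ *: _); rewrite scalerBr scalerBl addrA subrK.
apply: cvgD; last by apply: cvgZ; [exact: df|exact: cvg_cst].
apply: cvgZ; last exact: dg.
suff : {for 0, continuous (fun h : R => f (h *: v + x))}.
  by move=> /continuous_withinNx; rewrite scale0r add0r.
exact/differentiable_continuous/derivable1_diffP/(derivable1P _ _ _).1.
Qed.

Lemma CkZ k U f g : open U -> Ck k U f -> Ck k U g ->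
  Ck k U (fun x => f x *: g x).
Proof.
move=> oU; elim: k f g => [|k IH] f g Cf Cg; have cf := Ck_continuous Cf;
  have cg := Ck_continuous Cg; split => //.
- by move=> x Ux; apply: cvgZ; [exact: cf|exact: cg].
- by move=> x Ux; apply: cvgZ; [exact: cf|exact: cg].
- move=> v; have [dfv Dfv] := Cf.2 v; have [dgv Dgv] := Cg.2 v.
  have D x (Ux : U x) := is_derive_scale (dfv x Ux) (dgv x Ux).
  split=> [x /D []//|].
  apply: Ck_ext (CkD oU (IH _ _ (CkS Cf) Dgv) (IH _ _ Dfv (CkS Cg))) => // x Ux.
  by have [_ ->] := D x Ux.
Qed.

End smooth_onZ.

Record chart (R : realType) (n : nat) (M : topologicalType) := Chart {
  chart_dom : set M;
  chart_map :> M -> 'rV[R]_n;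
  chart_inv : 'rV[R]_n -> M;
  chart_dom_open : open chart_dom;
  chart_codom_open : open (chart_map @` chart_dom);
  chart_mapK : forall x, chart_dom x -> chart_inv (chart_map x) = x;
  chart_map_continuous : {within chart_dom, continuous chart_map};
  chart_inv_continuous :
    {within chart_map @` chart_dom, continuous chart_inv} }.

(* The atlas is not assumed to be maximal. *)
Record smooth_structure (R : realType) (n : nat) (M : topologicalType) :=
  SmoothStructure {
  atlas : set (chart R n M);
  atlas_cover : forall x, exists2 c, atlas c & chart_dom c x;
  atlas_compat : forall c d, atlas c -> atlas d ->
    smooth_on (c @` (chart_dom c `&` chart_dom d)) (d \o chart_inv c) }.

Record manifold (R : realType) (n : nat) := Manifold {
  manifold_sort :> topologicalType;
  manifold_structure : smooth_structure R n manifold_sort;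
  manifold_hausdorff : hausdorff_space manifold_sort;
  manifold_second_countable : @second_countable manifold_sort }.

Definition connected_manifold R n (M : manifold R n) : Prop :=
  [set: M] !=set0 /\ connected [set: M].

Section smooth_map_on.
Context {R : realType} {n : nat} (M : manifold R n).
Local Notation charts := (atlas (manifold_structure M)).

Definition smooth_map_on (W : normedModType R) (U : set M) (f : M -> W) :=
  forall c, charts c -> smooth_on (c @` (chart_dom c `&` U)) (f \o chart_inv c).

Lemma chart_img_open (c : chart R n M) (U : set M) :
  open U -> open (c @` (chart_dom c `&` U)).
Proof.
move=> oU; have oc := @chart_codom_open _ _ _ c.
have := @chart_inv_continuous _ _ _ c; rewrite continuous_open_subspace//.
move=> /(continuous_inP _ oc)/(_ _ oU).
congr open; apply/seteqP; split=> y /=.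
- by move=> [[x dx <-]]; rewrite chart_mapK// => Ux; exists x.
- by move=> [x [dx Ux] <-]; split; [exists x|rewrite chart_mapK].
Qed.

Lemma smooth_map_ext (W : normedModType R) (U : set M) (f g : M -> W) :
  open U -> (forall x, U x -> f x = g x) ->
  smooth_map_on U f -> smooth_map_on U g.
Proof.
move=> oU fg sf c Ac k; apply: Ck_ext (sf c Ac k).
  exact: chart_img_open.
by move=> _ [x [dx Ux] <-]; rewrite /= chart_mapK// fg.
Qed.

Lemma smooth_map_cst (W : normedModType R) (U : set M) (w : W) :
  open U -> smooth_map_on U (fun=> w).
Proof. by move=> oU c Ac k; apply: Ck_cst; exact: chart_img_open. Qed.

Lemma smooth_mapD (W : normedModType R) (U : set M) (f g : M -> W) :
  open U -> smooth_map_on U f -> smooth_map_on U g ->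
  smooth_map_on U (fun x => f x + g x).
Proof.
move=> oU sf sg c Ac k; apply: CkD (sf c Ac k) (sg c Ac k).
exact: chart_img_open.
Qed.

Lemma smooth_mapZ (W : normedModType R) (U : set M) (f : M -> R) (g : M -> W) :
  open U -> smooth_map_on U f -> smooth_map_on U g ->
  smooth_map_on U (fun x => f x *: g x).
Proof.
move=> oU sf sg c Ac k; apply: CkZ (sf c Ac k) (sg c Ac k).
exact: chart_img_open.
Qed.

Lemma smooth_map_sub (W : normedModType R) (U V : set M) (f : M -> W) :
  U `<=` V -> smooth_map_on V f -> smooth_map_on U f.
Proof.
move=> UV sf c Ac k; have := sf c Ac k.
have : c @` (chart_dom c `&` U) `<=` c @` (chart_dom c `&` V).
  by apply: image_subset; exact: setIS.
move: (c @` (_ `&` U)) (c @` (_ `&` V)) => A B AB.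
elim: k (f \o _) => [|k IH] g [cg dg]; split => //.
- by move=> x /AB; exact: cg.
- by move=> x /AB; exact: cg.
- move=> v; have [dgv Dgv] := dg v.
  by split=> [x /AB|]; [exact: dgv|exact: IH].
Qed.

End smooth_map_on.

Section smooth_functions.
Context {R : realType} {n : nat} (M : manifold R n).

Definition smooth_fun : {pred M -> R} :=
  fun f => `[< smooth_map_on (M := M) [set: M] f >].

Lemma smooth_funP (f : M -> R) :
  reflect (smooth_map_on (M := M) [set: M] f) (f \in smooth_fun).
Proof. exact: asboolP. Qed.

Lemma smooth_fun_subring : subring_closed smooth_fun.
Proof.
have sM (f g : M -> R) : f \in smooth_fun -> g \in smooth_fun ->
    f * g \in smooth_fun.
  move=> /smooth_funP sf /smooth_funP sg; apply/smooth_funP.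
  exact: (smooth_mapZ openT sf sg).
have sC (a : R) : cst a \in smooth_fun.
  by apply/smooth_funP; exact: smooth_map_cst openT.
split=> [|f g sf sg|]; [exact: (sC 1)| |exact: sM].
have -> : f - g = f + cst (-1) * g.
  by apply/funext => x; rewrite !fctE mulN1r.
apply/smooth_funP; apply: (smooth_mapD openT); apply/smooth_funP => //.
exact: sM.
Qed.
HB.instance Definition _ :=
  GRing.isSubringClosed.Build (M -> R) smooth_fun smooth_fun_subring.

Lemma smooth_fun_scaler : GRing.scaler_closed smooth_fun.
Proof.
move=> a f /smooth_funP sf; apply/smooth_funP.
exact: (smooth_mapZ openT (smooth_map_cst a openT) sf).
Qed.
HB.instance Definition _ :=
  GRing.isScaleClosed.Build R (M -> R) smooth_fun smooth_fun_scaler.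

Record smoothFun := SmoothFun {
  smoothFun_val :> M -> R;
  smoothFunP : smoothFun_val \in smooth_fun }.
HB.instance Definition _ := [isSub for smoothFun_val].
HB.instance Definition _ := [Choice of smoothFun by <:].
HB.instance Definition _ := GRing.SubChoice_isSubComPzRing.Build
  (M -> R) smooth_fun smoothFun smooth_fun_subring.
HB.instance Definition _ := [SubZmodule_isSubLmodule of smoothFun by <:].

End smooth_functions.
Arguments smooth_fun {R n} M _.

Record local_trivialization (R : realType) (n r : nat) (M : manifold R n)
    (V : M -> lmodType R) := LocalTrivialization {
  triv_dom : set M;
  triv_map : forall x, {linear V x -> 'rV[R]_r};
  triv_inv : forall x, 'rV[R]_r -> V x;
  triv_dom_open : open triv_dom;
  triv_mapK : forall x, triv_dom x -> cancel (triv_map x) (@triv_inv x);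
  triv_invK : forall x, triv_dom x -> cancel (@triv_inv x) (triv_map x) }.

(* The bundle is given by its fibres and by fibrewise linear trivializations
   over an open cover, whose transition functions are smooth maps to GL_r. *)
Record vector_bundle (R : realType) (n : nat) (M : manifold R n) (r : nat) :=
  VectorBundle {
  fiber :> M -> lmodType R;
  trivializations : set (local_trivialization r fiber);
  triv_cover : forall x, exists2 t, trivializations t & triv_dom t x;
  triv_compat : forall t u, trivializations t -> trivializations u ->
    forall v : 'rV[R]_r, smooth_map_on (triv_dom t `&` triv_dom u)
      (fun x => triv_map u x (triv_inv t x v)) }.
Arguments trivializations {R n M r} V _ : rename.

Section sections.
Context {R : realType} {n r : nat} {M : manifold R n} (V : vector_bundle M r).

Definition smooth_section (s : forall x, V x) : Prop :=
  forall t, trivializations V t ->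
    smooth_map_on (triv_dom t) (fun x => triv_map t x (s x)).

Record section := Section {
  section_val :> forall x, V x;
  sectionP : smooth_section section_val }.

HB.instance Definition _ := gen_eqMixin section.
HB.instance Definition _ := gen_choiceMixin section.

Lemma section_eq (s s' : section) : (forall x, s x = s' x) -> s = s'.
Proof.
case: s s' => [s sP] [s' s'P] /= ss'.
have e : s = s' by exact: functional_extensionality_dep.
by case: _ / e s'P {ss'} => s'P; rewrite (Prop_irrelevance sP s'P).
Qed.

Lemma smooth_section_add (f : smoothFun M) (s s' : section) :
  smooth_section (fun x => f x *: s x + s' x).
Proof.
move=> t Vt; have ot := @triv_dom_open _ _ _ _ _ t.
apply: (@smooth_map_ext _ _ _ _ _
    (fun x => f x *: triv_map t x (s x) + triv_map t x (s' x))) => //.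
  by move=> x _; rewrite linearP.
apply: smooth_mapD => //; last exact: sectionP.
apply: smooth_mapZ => //; last exact: sectionP.
by have /smooth_funP sf := smoothFunP f; apply: smooth_map_sub sf.
Qed.

Lemma smooth_section_zero : smooth_section (fun=> 0).
Proof.
move=> t Vt; have ot := @triv_dom_open _ _ _ _ _ t.
apply: (@smooth_map_ext _ _ _ _ _ (fun=> 0)) => //.
  by move=> x _; rewrite linear0.
exact: smooth_map_cst.
Qed.

Definition lincomb_section (f : smoothFun M) (s s' : section) : section :=
  Section (smooth_section_add f s s').
Definition zero_section : section := Section smooth_section_zero.

Let addA : associative (lincomb_section 1).
Proof. by move=> s t u; apply: section_eq => x /=; rewrite !scale1r addrA. Qed.
Let addC : commutative (lincomb_section 1).
Proof. by move=> s t; apply: section_eq => x /=; rewrite !scale1r addrC. Qed.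
Let add0 : left_id zero_section (lincomb_section 1).
Proof. by move=> s; apply: section_eq => x /=; rewrite scale1r add0r. Qed.
Let addN : left_inverse zero_section
  (fun s => lincomb_section (-1) s zero_section) (lincomb_section 1).
Proof.
by move=> s; apply: section_eq => x /=; rewrite scale1r scaleN1r addr0 addNr.
Qed.
HB.instance Definition _ := GRing.isZmodule.Build section addA addC add0 addN.

Lemma sectionD (s t : section) x : (s + t) x = s x + t x.
Proof. by rewrite -[in RHS](scale1r (s x)). Qed.

Lemma section0 x : (0 : section) x = 0.
Proof. by []. Qed.

Let scale (f : smoothFun M) (s : section) := lincomb_section f s 0.
Let scaleE f s x : scale f s x = f x *: s x.
Proof. by rewrite /= addr0. Qed.
Let scaleA f g s : scale f (scale g s) = scale (f * g) s.
Proof. by apply: section_eq => x; rewrite !scaleE scalerA. Qed.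
Let scale1 : left_id 1 scale.
Proof. by move=> s; apply: section_eq => x; rewrite scaleE scale1r. Qed.
Let scaleDr : right_distributive scale +%R.
Proof.
by move=> f s t; apply: section_eq => x; rewrite !(scaleE, sectionD) scalerDr.
Qed.
Let scaleDl s : {morph scale^~ s : f g / f + g}.
Proof.
by move=> f g; apply: section_eq => x; rewrite !(scaleE, sectionD) scalerDl.
Qed.
HB.instance Definition _ := GRing.Zmodule_isLmodule.Build (smoothFun M) section
  scaleA scale1 scaleDr scaleDl.

Lemma sectionZ (f : smoothFun M) (s : section) x : (f *: s) x = f x *: s x.
Proof. exact: scaleE. Qed.

Lemma sectionN (s : section) x : (- s) x = - s x.
Proof. by rewrite -scaleN1r sectionZ /= scaleN1r. Qed.

End sections.

Record kv_algebra_bundle (R : realType) (n r : nat) (M : manifold R n)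
    (V : vector_bundle M r) := KVAlgebraBundle {
  kv_mul : section V -> section V -> section V;
  kv_mul_linearl : forall s', linear (kv_mul^~ s');
  kv_mul_linearr : forall s, linear (kv_mul s);
  kv_identity : forall a b c,
    kv_mul a (kv_mul b c) - kv_mul (kv_mul a b) c =
    kv_mul b (kv_mul a c) - kv_mul (kv_mul b a) c }.

Section kv_cohomology.
Context {R : realType} {n r : nat} {M : manifold R n} {V : vector_bundle M r}.
Variable A : kv_algebra_bundle V.
Local Notation Gamma := (section V).
Local Notation F := (smoothFun M).
Local Notation "s ** t" := (kv_mul A s t) (at level 40).

Definition bilinear_cochain (Theta : Gamma -> Gamma -> F) : Prop :=
  (forall s', scalar (Theta^~ s')) /\ (forall s, scalar (Theta s)).

Definition kv_delta2 (Theta : Gamma -> Gamma -> F) (s s' s'' : Gamma) : F :=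
  Theta (s ** s') s'' + Theta s' (s ** s'')
  - Theta (s' ** s) s'' - Theta s (s' ** s'').

Definition kv_delta1 (Theta : {scalar Gamma}) (s s' : Gamma) : F :=
  Theta (s ** s').

Definition is_cocycle2 : {pred Gamma -> Gamma -> F} := fun Theta =>
  `[< bilinear_cochain Theta /\
      forall s s' s'', kv_delta2 Theta s s' s'' = 0 >].

Lemma is_cocycle2_zmod_closed : zmod_closed is_cocycle2.
Proof.
split=> [|p q /asboolP[[pl pr] dp] /asboolP[[ql qr] dq]]; apply/asboolP.
  split; [split=> s a u v|move=> s s' s''].
  - by change (0 = a * 0 + 0 :> F); rewrite mulr0 addr0.
  - by change (0 = a * 0 + 0 :> F); rewrite mulr0 addr0.
  - by change (0 + 0 - 0 - 0 = 0 :> F); rewrite addr0 !subr0.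
have E s t : (p - q) s t = p s t - q s t by [].
split; [split=> s a u v|move=> s s' s''].
- by rewrite /= !E pl ql mulrBr opprD addrACA.
- by rewrite /= !E pr qr mulrBr opprD addrACA.
- rewrite -[RHS](subrr (0 : F)) -{1}(dp s s' s'') -(dq s s' s'').
  by rewrite /kv_delta2 !E; ring.
Qed.
HB.instance Definition _ := GRing.isZmodClosed.Build (Gamma -> Gamma -> F)
  is_cocycle2 is_cocycle2_zmod_closed.

Record cocycle2 := Cocycle2 {
  cocycle2_val :> Gamma -> Gamma -> F;
  cocycle2P : cocycle2_val \in is_cocycle2 }.
HB.instance Definition _ := [isSub for cocycle2_val].
HB.instance Definition _ := [Choice of cocycle2 by <:].
HB.instance Definition _ := [SubChoice_isSubZmodule of cocycle2 by <:].

Lemma kv_delta1_cocycle (Theta : {scalar Gamma}) :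
  kv_delta1 Theta \in is_cocycle2.
Proof.
apply/asboolP; split; [split=> s a u v|move=> s s' s'']; rewrite /kv_delta1 /=.
- by rewrite kv_mul_linearl linearP.
- by rewrite kv_mul_linearr linearP.
- rewrite /kv_delta2 -raddfD -!raddfB /=.
  have -> (p q u v : Gamma) : p + q - u - v = (q - u) - (v - p).
    by rewrite opprB (addrC p) -!addrA; congr +%R; rewrite addrCA.
  by rewrite kv_identity subrr raddf0.
Qed.

Definition is_coboundary2 : {pred cocycle2} := fun z =>
  `[< exists Theta : {scalar Gamma}, z = Cocycle2 (kv_delta1_cocycle Theta) >].

Lemma is_coboundary2_zmod_closed : zmod_closed is_coboundary2.
Proof.
split=> [|p q /asboolP[P ->] /asboolP[P' ->]]; apply/asboolP.
  by exists (\0 : {scalar Gamma}); apply: val_inj.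
by exists ((P \- P') : {scalar Gamma}); apply: val_inj.
Qed.
HB.instance Definition _ := GRing.isZmodClosed.Build cocycle2
  is_coboundary2 is_coboundary2_zmod_closed.

Definition kv_H2 : zmodType := {ideal_quot is_coboundary2}.

Definition kv_class (z : cocycle2) : kv_H2 :=
  (\pi_{ideal_quot is_coboundary2} z)%qT.

End kv_cohomology.

(* Non asymmetric Courant algebroids whose anchor and 1-cocycle are zero: the
   left multiplications are skew for the form. *)
Record courant_algebroid (R : realType) (n r : nat) (M : manifold R n)
    (V : vector_bundle M r) := CourantAlgebroid {
  courant_kv :> kv_algebra_bundle V;
  fiber_form : forall x, V x -> V x -> R;
  form_sym : forall x (u v : V x), fiber_form u v = fiber_form v u;
  form_linear : forall x (u : V x), scalar (fiber_form u);
  form_nondegenerate : forall x (u : V x),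
    (forall v, fiber_form u v = 0) -> u = 0;
  form_smooth : forall s s' : section V,
    (fun x => fiber_form (s x) (s' x)) \in smooth_fun M;
  form_invariant : forall s s' s'' : section V, forall x,
    fiber_form (kv_mul courant_kv s s' x) (s'' x) +
    fiber_form (s' x) (kv_mul courant_kv s s'' x) = 0 }.

Section courant_theory.
Context {R : realType} {n r : nat} {M : manifold R n} {V : vector_bundle M r}.
Variable A : courant_algebroid V.

Definition form_cochain (s s' : section V) : smoothFun M :=
  SmoothFun (form_smooth A s s').

Lemma form_cocycle : form_cochain \in is_cocycle2 A.
Proof.
have inv s s' s'' : form_cochain (kv_mul A s s') s'' +
    form_cochain s' (kv_mul A s s'') = 0.
  by apply: val_inj; apply/funext => x; exact: form_invariant.
apply/asboolP; split; [split=> s a u v|move=> s s' s''].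
- apply: val_inj; apply/funext => x.
  change (fiber_form A ((a *: u + v) x) (s x) =
    a x * fiber_form A (u x) (s x) + fiber_form A (v x) (s x)).
  by rewrite sectionD sectionZ !(form_sym _ _ (s x)) form_linear.
- apply: val_inj; apply/funext => x.
  change (fiber_form A (s x) ((a *: u + v) x) =
    a x * fiber_form A (s x) (u x) + fiber_form A (s x) (v x)).
  by rewrite sectionD sectionZ form_linear.
- by rewrite /kv_delta2 inv add0r -opprD inv oppr0.
Qed.

Definition form_class : kv_H2 A := kv_class (Cocycle2 form_cocycle).

Definition definite_form : Prop := forall x : M,
  (forall u : V x, u != 0 -> 0 < fiber_form A u u) \/
  (forall u : V x, u != 0 -> fiber_form A u u < 0).

End courant_theory.

#[short(type="groupTopologicalType")]
HB.structure Definition GroupTopological := {G of Group G & Topological G}.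

Local Open Scope group_scope.
Record lie_group (R : realType) (n : nat) := LieGroup {
  lie_sort :> groupTopologicalType;
  lie_structure : smooth_structure R n lie_sort;
  lie_hausdorff : hausdorff_space lie_sort;
  lie_second_countable : @second_countable lie_sort;
  lie_mul_continuous : continuous (fun p : lie_sort * lie_sort => p.1 * p.2);
  lie_inv_continuous : continuous (fun g : lie_sort => g^-1);
  lie_mul_smooth : forall a b c, atlas lie_structure a ->
    atlas lie_structure b -> atlas lie_structure c ->
    smooth_on [set p : 'rV[R]_n * 'rV[R]_n |
        (a @` chart_dom a) p.1 /\ (b @` chart_dom b) p.2 /\
        chart_dom c (chart_inv a p.1 * chart_inv b p.2)]
      (fun p => c (chart_inv a p.1 * chart_inv b p.2));
  lie_inv_smooth : forall a b, atlas lie_structure a -> atlas lie_structure b ->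
    smooth_on [set y | (a @` chart_dom a) y /\ chart_dom b (chart_inv a y)^-1]
      (fun y => b (chart_inv a y)^-1) }.

Definition lie_manifold R n (G : lie_group R n) : manifold R n :=
  Manifold (lie_structure G) (@lie_hausdorff _ _ G)
    (@lie_second_countable _ _ G).
Local Close Scope group_scope.

Section left_invariant_fields.
Context {R : realType} {n : nat} (G : lie_group R n).
Local Notation F := (smoothFun (lie_manifold G)).

(* Vector fields on G are R-linear derivations of F(G).  Left invariance,
   X (f \o L_g) = (X f) \o L_g, is stated with a variable f_g for f \o L_g. *)
Definition left_invariant_field (X : {linear F -> F}) : Prop :=
  (forall f h : F, X (f * h) = X f * h + f * X h) /\
  forall (g : G) (f f_g : F), (forall y : G, f_g y = f (g * y)%g) ->
    forall y : G, X f_g y = X f (g * y)%g.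

End left_invariant_fields.

Definition simply_connected (R : realType) (T : topologicalType) : Prop :=
  forall gamma : R -> T, {within `[0, 1], continuous gamma} ->
    gamma 0 = gamma 1 ->
  exists H : R * R -> T,
    [/\ {within `[0, 1] `*` `[0, 1], continuous H},
        forall t, t \in `[0, 1] -> H (0, t) = gamma t,
        forall t, t \in `[0, 1] -> H (1, t) = gamma 0 &
        forall s, s \in `[0, 1] -> H (s, 0) = gamma 0 /\ H (s, 1) = gamma 0].

Section lattices.
Variables (G : groupTopologicalType) (L : groupClosed G).
Local Open Scope group_scope.

Definition same_coset (g h : G) : bool := h * g^-1 \in L.

Lemma same_coset_equiv : equiv_class_of same_coset.
Proof.
split=> [g|g h|h g k]; rewrite /same_coset.
- by rewrite mulgV gpred1.
- by rewrite -gpredV invgM invgK.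
- by move=> gh hk; rewrite -[k](mulgVK h) -mulgA gpredM.
Qed.
Canonical same_coset_equivRel := EquivRelPack same_coset_equiv.

Definition coset_space : topologicalType :=
  quotient_topology {eq_quot same_coset}%qT.

Definition cocompact_lattice : Prop :=
  (forall g, g \in L ->
    exists2 U : set G, open U & U `&` [set h | h \in L] = [set g]) /\
  compact [set: coset_space].

End lattices.

Section cocompact.
Context {R : realType} {n r : nat} {M : manifold R n} {V : vector_bundle M r}.
Variable A : courant_algebroid V.

Definition section_bracket (s s' : section V) : section V :=
  kv_mul A s s' - kv_mul A s' s.

(* phi is an isomorphism of the Lie algebra V_x onto the Lie algebra of G,
   i.e. the left-invariant vector fields on G with the commutator bracket;
   every pair of vectors of V_x is of the form s x, s' x. *)
Definition fiber_lie_iso (x : M) (G : lie_group R r)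
    (phi : V x -> {linear smoothFun (lie_manifold G) ->
                           smoothFun (lie_manifold G)}) : Prop :=
  [/\ forall u, left_invariant_field (phi u),
      forall X, left_invariant_field X -> exists u, phi u =1 X,
      forall u v, phi u =1 phi v -> u = v,
      forall (a : R) u v f, phi (a *: u + v) f = a *: phi u f + phi v f &
      forall (s s' : section V) f, phi (section_bracket s s' x) f =
        phi (s x) (phi (s' x) f) - phi (s' x) (phi (s x) f)].

(* The group G_x is unique up to isomorphism. *)
Definition cocompact_algebroid : Prop := forall x : M,
  exists G : lie_group R r,
    [/\ connected [set: G], simply_connected R G,
        exists phi, @fiber_lie_iso x G phi &
        exists L : groupClosed G, cocompact_lattice L].

End cocompact.

(* Main.v *)
From HB Require Import structures.
Require Import Defs.
From mathcomp Require Import all_boot all_order all_algebra.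
From mathcomp Require Import all_classical all_reals all_analysis.
From mathcomp Require Import generic_quotient ring_quotient.
From mathcomp Require Import ring.
Import numFieldNormedType.Exports.
Import Order.TTheory GRing.Theory Num.Theory.

Set Implicit Arguments.
Unset Strict Implicit.
Unset Printing Implicit Defensive.

Local Open Scope classical_set_scope.
Local Open Scope ring_scope.
(** Suppose that the form is a coboundary, <s, s'> = theta(s s').  Let h be the
    section dual to theta, so that <s, s'> = <h, s s'>.  Left multiplications
    are skew, hence <h, h> = <h, h h> = 0; a definite form then forces h = 0,
    hence the form vanishes, which is absurd in positive rank.  The argument
    takes place over a single point x of M.

    The section h cannot be read off pointwise at once, because theta is only
    known to be a linear functional on global sections.  The remedy is to choose
    r sections e_i whose values at x form a basis ([frame_at]), and to invert
    their Gram matrix g without dividing: with D = det g, the section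
      h = sum_(i, j) adj(g)_(j, i) theta(e_i) e_j
    satisfies D^2 theta(w) = D <h, w> for every section w ([gram_dualP]).  This
    identity is global because the e_i span the fibres wherever D is nonzero
    ([gram_expansion]).  Since D(x) is nonzero ([gram_det_neq0]), it can be used
    at x in place of theta = <h, ->.

    Global sections with prescribed values at x come from a smooth bump function
    ([bump_function]): in a chart, exp(-1/u) applied to a function u that is
    positive only inside a small cube.  Smoothness is defined by iterated
    directional derivatives, and composition with a function of one real
    variable is the only chain rule that this construction requires. *)

(** * The flat function exp(-1/x) *)

Section flat_functions.
Context {R : realType}.
Implicit Types (p : {poly R}) (x : R).

(** The polynomial factor makes the family closed under differentiation, so that
    smoothness of exp(-1/x) follows by induction over the whole family. *)
Definition flat p x : R := if 0 < x then p.[x^-1] * expR (- x^-1) else 0.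

Lemma expRN_inv_le (m : nat) x : 0 < x ->
  expR (- x^-1) <= m.+1`!%:R * x ^+ m.+1.
Proof.
move=> x0; have xV0 : 0 <= x^-1 by rewrite invr_ge0 ltW.
have fact0 : 0 < m.+1`!%:R :> R by rewrite ltr0n fact_gt0.
rewrite expRN -[leRHS]invrK lef_pV2 ?posrE ?expR_gt0//; last first.
  by rewrite invr_gt0 mulr_gt0// exprn_gt0.
apply: le_trans (expR_ge1Dxn m xV0); rewrite invfM mulrC -exprVn.
by rewrite lerDr.
Qed.

(** The induction on [p] trades a factor 1/x for one power of [x], hence the
    quantification over all orders of vanishing. *)
Lemma flat_bound p (m : nat) : exists C : R,
  forall x, `|flat p x| <= C * `|x| ^+ m.+1.
Proof.
suff [C HC] : exists C : R, forall x, 0 < x ->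
    `|p.[x^-1] * expR (- x^-1)| <= C * x ^+ m.+1.
  have C0 : 0 <= C.
    by have := HC 1 ltr01; rewrite expr1n mulr1; apply: le_trans.
  exists C => x; rewrite /flat; case: ifP => x0; last first.
    by rewrite normr0 mulr_ge0// exprn_ge0.
  by rewrite (gtr0_norm x0); exact: HC.
elim/poly_ind: p m => [|p c IH] m.
  by exists 0 => x _; rewrite horner0 !mul0r normr0.
have [C HC] := IH m.+1.
exists (C + `|c| * m.+1`!%:R) => x x0.
rewrite hornerMXaddC mulrDl (le_trans (ler_normD _ _))// mulrDl.
apply: lerD.
  rewrite mulrAC normrM (gtr0_norm (_ : 0 < x^-1)) ?invr_gt0//.
  by rewrite ler_pdivrMr// -mulrA -exprSr; exact: HC.
rewrite normrM (gtr0_norm (expR_gt0 _)) -mulrA ler_wpM2l//.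
exact: expRN_inv_le.
Qed.

(** With u = 1/x one has du/dx = - u^2, so the derivative of P(u) exp(-u) in [x]
    is u^2 (P(u) - P'(u)) exp(-u). *)
Definition flat_deriv p : {poly R} := 'X ^+ 2 * (p - p^`()).

(** At 0 the difference quotient tends to 0 because [flat p] is O(x^2). *)
Lemma is_derive_flat p x : is_derive x 1 (flat p) (flat (flat_deriv p) x).
Proof.
have [x0|x0|->] := ltrgtP x 0.
- rewrite {2}/flat ltNge (ltW x0)/=.
  apply: (near_eq_is_derive (f := cst (0 : R))).
    near=> y; rewrite /flat ltNge ltW//=; near: y; exact: lt_nbhsl.
- rewrite {2}/flat x0.
  apply: (near_eq_is_derive
    (f := (horner p \o GRing.inv) * (expR \o (- (GRing.inv : R -> R))))).
    near=> y; rewrite /flat [X in if X then _ else _](_ : _ = true)//.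
    by near: y; exact: lt_nbhsr.
  have xn0 : x != 0 by rewrite gt_eqF.
  have dV : is_derive x 1 (GRing.inv : R -> R) (- x ^- 2 *: 1).
    exact: (@is_deriveV _ id).
  have dP := is_derive1_comp (is_derive_poly p x^-1) dV.
  have dE := is_derive1_comp (g := - (GRing.inv : R -> R))
    (is_derive_expR (- x^-1)) (is_deriveN dV).
  apply: is_derive_eq (is_deriveM dP dE) _.
  rewrite /flat_deriv !hornerE /= /GRing.scale /=.
  by field.
- rewrite {2}/flat ltxx; have [C HC] := flat_bound p 1.
  suff L : (fun h : R => h^-1 *: ((flat p \o shift 0) (h *: 1) - flat p 0))
      @ 0^' --> (0 : R).
    by apply: DeriveDef; [apply: cvgP L|exact: cvg_lim L].
  have L0 : (fun h : R => C * `|h|) @ 0^' --> (0 : R).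
    suff : {for 0, continuous (fun h : R => C * `|h|)}.
      by move=> /continuous_withinNx; rewrite normr0 mulr0.
    by move=> ?; apply: cvgM; [exact: cvg_cst|exact: norm_continuous].
  apply/cvgr0Pnorm_le => e e0.
  near=> h.
  have h0 : h != 0 by near: h; exact: nbhs_dnbhs_neq.
  have : `|C * `|h| | <= e by near: h; exact: ((cvgr0Pnorm_le _).1 L0 e e0).
  apply: le_trans.
  rewrite /= addr0 [h *: 1]mulr1 {2}/flat ltxx subr0 [_ *: _]mulrC.
  rewrite normrM normfV ler_pdivrMr ?normr_gt0//.
  apply: le_trans (HC h) _; rewrite normrM normr_id -mulrA.
  by rewrite ler_wpM2r ?mulr_ge0// ler_norm.
Unshelve. all: end_near.
Qed.
End flat_functions.

(** * Operations on functions of class C^k *)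

Section Ck_operations.
Context {R : realType} {E : normedModType R}.
Implicit Types (U : set E) (W : normedModType R).

Lemma Ck_union W k U U' (f : E -> W) :
  Ck k U f -> Ck k U' f -> Ck k (U `|` U') f.
Proof.
elim: k f => [|k IH] f [cf df] [cf' df']; split => //.
- by move=> x [/cf|/cf'].
- by move=> x [/cf|/cf'].
- move=> v; have [dfv Dfv] := df v; have [dfv' Dfv'] := df' v.
  by split=> [x [/dfv|/dfv']//|]; exact: IH.
Qed.

Lemma is_derive_coord n (f : E -> 'rV[R]_n) (i : 'I_n) x v :
  derivable f x v -> is_derive x v (fun y => f y ord0 i) ('D_v f x ord0 i).
Proof.
move=> df.
suff L : (fun h => h^-1 *: (((fun y => f y ord0 i) \o shift x) (h *: v) -
    f x ord0 i)) @ 0^' --> 'D_v f x ord0 i.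
  by apply: DeriveDef; [apply: cvgP L|exact: cvg_lim L].
rewrite [X in X @ _](_ : _ = (fun z : 'rV[R]_n => z ord0 i) \o
    (fun h => h^-1 *: ((f \o shift x) (h *: v) - f x))).
  apply: cvg_comp; [exact: df|exact: coord_continuous].
by apply/funext => h; rewrite /= !mxE.
Qed.

Lemma Ck_coord n k U (f : E -> 'rV[R]_n) (i : 'I_n) :
  open U -> Ck k U f -> Ck k U (fun x => f x ord0 i).
Proof.
move=> oU; elim: k f => [|k IH] f [cf df].
  by split=> // x Ux;
    apply: (@continuous_comp _ _ _ f (fun z : 'rV[R]_n => z ord0 i));
      [exact: cf|exact: coord_continuous].
split=> [x Ux|v].
  by apply: (@continuous_comp _ _ _ f (fun z : 'rV[R]_n => z ord0 i));
      [exact: cf|exact: coord_continuous].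
have [dfv Dfv] := df v; split=> [x Ux|].
  by have [] := is_derive_coord i (dfv x Ux).
apply: Ck_ext (IH _ Dfv) => // x Ux.
by have [_ ->] := is_derive_coord i (dfv x Ux).
Qed.

Lemma Ck_sum (I : Type) (s : seq I) W k U (f : I -> E -> W) :
  open U -> (forall i, Ck k U (f i)) -> Ck k U (fun x => \sum_(i <- s) f i x).
Proof.
move=> oU Cf; elim: s => [|i s IH].
  by apply: Ck_ext (Ck_cst k 0 oU) => // x _; rewrite big_nil.
by apply: Ck_ext (CkD oU (Cf i) IH) => // x _; rewrite big_cons.
Qed.

Lemma derive_line W (f : E -> W) x v :
  'D_1 (fun h : R => f (h *: v + x)) 0 = 'D_v f x.
Proof.
rewrite /derive; set q1 := fun h => _; set q2 := fun h => _.
suff -> : q1 = q2 by [].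
apply/funext => h; rewrite /q1 /q2 /=.
by rewrite addr0 [h *: 1]mulr1 scale0r add0r.
Qed.

Lemma is_derive_comp_real (phi : R -> R) (a : R) (f : E -> R) x v :
  is_derive (f x) 1 phi a -> derivable f x v ->
  is_derive x v (phi \o f) (a * 'D_v f x).
Proof.
move=> dphi /derivable1P/derivableP df.
have line0 : f x = (fun h : R => f (h *: v + x)) 0 by rewrite scale0r add0r.
rewrite line0 in dphi; have [d e] := is_derive1_comp dphi df.
by apply: DeriveDef; [exact/derivable1P|rewrite -derive_line e derive_line].
Qed.

(** The derivative of [flat p \o f] along [v] is again a product of a function of
    the same form and a derivative of [f]; this closes the induction on [k]. *)
Lemma Ck_flat p k U (f : E -> R) :
  open U -> Ck k U f -> Ck k U (flat p \o f).
Proof.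
have cont q (g : E -> R) x : {for x, continuous g} ->
    {for x, continuous (flat q \o g)}.
  move=> cg; apply: (@continuous_comp _ _ _ g (flat q)); first exact: cg.
  apply/differentiable_continuous/derivable1_diffP.
  by have [] := is_derive_flat q (g x).
move=> oU; elim: k p f => [|k IH] p f Cf; have cf := Ck_continuous Cf.
  by split=> // x /cf; exact: cont.
have D x v (Ux : U x) := is_derive_comp_real
  (is_derive_flat p (f x)) ((Cf.2 v).1 x Ux).
split=> [x /cf|v]; first exact: cont.
split=> [x Ux|]; first by have [] := D x v Ux.
apply: Ck_ext (CkZ oU (IH (flat_deriv p) f (CkS Cf)) (Cf.2 v).2) => // x Ux.
by have [_ ->] := D x v Ux.
Qed.

End Ck_operations.

(** * Bump functions on a manifold *)

Section bump.
Context {R : realType}.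

Lemma cube_subset n (U : set 'rV[R]_n) (a : 'rV[R]_n) : open U -> U a ->
  exists2 e : R, 0 < e &
    [set z : 'rV[R]_n | forall i, `|z ord0 i - a ord0 i| <= e] `<=` U.
Proof.
move=> oU Ua; have /nbhs_ballP[e /= e0 He] : nbhs a U by exact: open_nbhs_nbhs.
exists (e / 2); first by rewrite divr_gt0.
move=> z Hz; apply: He; split=> // i j; rewrite (ord1 i) /ball /= distrC.
by rewrite (le_lt_trans (Hz j))// ltr_pdivrMr// ltr_pMr// ltr1n.
Qed.

Lemma cube_compact n (a : 'rV[R]_n) (e : R) :
  compact [set z : 'rV[R]_n | forall i, `|z ord0 i - a ord0 i| <= e].
Proof.
have -> : [set z : 'rV[R]_n | forall i, `|z ord0 i - a ord0 i| <= e] =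
    [set z : 'rV[R]_n | forall i, [set` `[a ord0 i - e, a ord0 i + e]] (z ord0 i)].
  by apply/seteqP; split=> z Hz i; have := Hz i; rewrite /= in_itv/= ler_distl.
by apply: (@rV_compact R n (fun i =>
  [set` `[a ord0 i - e, a ord0 i + e]])) => i; exact: segment_compact.
Qed.

(** The argument of the flat function is positive only on the ball of radius [e];
    the support is compared with the cube around it since compactness of cubes
    is a statement about products of segments. *)
Definition cube_bump n (a : 'rV[R]_n) (e : R) (z : 'rV[R]_n) : R :=
  flat 1 (e ^+ 2 - \sum_i (z ord0 i - a ord0 i) ^+ 2).

Lemma cube_bump_center n (a : 'rV[R]_n) (e : R) : 0 < e -> 0 < cube_bump a e a.
Proof.
move=> e0; rewrite /cube_bump /flat big1 ?subr0 => [|i _]; last first.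
  by rewrite subrr expr0n.
by rewrite exprn_gt0// hornerE mul1r expR_gt0.
Qed.

Lemma cube_bump_eq0 n (a : 'rV[R]_n) (e : R) (z : 'rV[R]_n) : 0 < e ->
  ~ (forall i, `|z ord0 i - a ord0 i| <= e) -> cube_bump a e z = 0.
Proof.
move=> e0 /existsNP[i /negP]; rewrite -ltNge => ei.
rewrite /cube_bump /flat subr_gt0 ltNge (_ : _ <= _)//.
rewrite (bigD1 i)//= -[X in _ <= X + _]real_normK ?num_real// ler_wpDr//.
  by rewrite sumr_ge0// => j _; rewrite sqr_ge0.
by rewrite lerXn2r ?nnegrE ?(ltW e0)// ltW.
Qed.

Lemma Ck_cube_bump (E : normedModType R) n (a : 'rV[R]_n) (e : R) k
    (U : set E) (f : E -> 'rV[R]_n) :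
  open U -> Ck k U f -> Ck k U (cube_bump a e \o f).
Proof.
move=> oU Cf; apply: (@Ck_flat _ _ 1 k U (fun x =>
  e ^+ 2 - \sum_i (f x ord0 i - a ord0 i) ^+ 2)) => //.
pose g i x := f x ord0 i - a ord0 i.
have Cg i : Ck k U (g i) by apply: CkD => //; [exact: Ck_coord|exact: Ck_cst].
apply: CkD => //; first exact: Ck_cst.
have Cs := Ck_sum (index_enum _) oU (fun i => CkZ oU (Cg i) (Cg i)).
by apply: (Ck_ext oU _ (CkZ oU (Ck_cst k (-1 : R) oU) Cs)) => x _; rewrite scaleN1r.
Qed.

Lemma smooth_map_union n (M : manifold R n) (W : normedModType R)
    (U U' : set M) (f : M -> W) :
  smooth_map_on U f -> smooth_map_on U' f -> smooth_map_on (U `|` U') f.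
Proof.
move=> sf sf' c Ac k; rewrite setIUr image_setU.
by apply: Ck_union; [exact: sf|exact: sf'].
Qed.

(** The function vanishes on an open [N] which covers [M] together with [U]: this
    form of the support condition lets one check smoothness of products with
    [chi] on the two open pieces separately.  The set [N] is open because it is
    the complement of the image of a compact cube in a Hausdorff space. *)
Lemma bump_function n (M : manifold R n) (U : set M) (x : M) :
  open U -> U x -> exists (chi : smoothFun M) (N : set M),
    [/\ open N, N `|` U = setT, forall y, N y -> chi y = 0 & chi x != 0].
Proof.
move=> oU Ux; have [c Ac cx] := atlas_cover (manifold_structure M) x.
have [e e0 cubeU] := cube_subset (chart_img_open (c := c) oU)
  (ex_intro2 _ _ x (conj cx Ux) erefl).
set a := c x in cubeU; set K := [set z | _] in cubeU.
pose chi y := if `[< chart_dom c y >] then cube_bump a e (c y) else 0.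
have inK z : K z -> chart_dom c (chart_inv c z) /\ U (chart_inv c z).
  by move=> /cubeU[y [dy Uy] <-]; rewrite chart_mapK.
pose N := ~` (chart_inv c @` K).
have oN : open N.
  apply: closed_openC; apply: compact_closed; first exact: manifold_hausdorff.
  apply: continuous_compact; last exact: cube_compact.
  apply: continuous_subspaceW (@chart_inv_continuous _ _ _ c).
  by move=> z /cubeU[y [dy _] <-]; exists y.
have N0 y : N y -> chi y = 0.
  move=> Ny; rewrite /chi; case: asboolP => // dy; apply: cube_bump_eq0 => // Ky.
  by apply: Ny; exists (c y) => //; rewrite chart_mapK.
have Nd : N `|` chart_dom c = setT.
  apply/seteqP; split=> // y _; have [Ny|Ny] := pselect (N y); first by left.
  by right; have [z /inK[dz _] <-] := contrapT Ny.
have schi : smooth_map_on setT chi.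
  rewrite -Nd; apply: smooth_map_union.
    by apply: smooth_map_ext (smooth_map_cst (0 : R) oN) => // y /N0.
  have od := @chart_dom_open _ _ _ c.
  move=> d Ad k.
  have odc := chart_img_open (c := d) od.
  have := atlas_compat Ad Ac.
  move=> /(_ k)/(Ck_cube_bump a e odc); apply: Ck_ext => //.
  move=> _ [y [dy cy] <-]; rewrite /= chart_mapK// /chi.
  by case: asboolP.
exists (SmoothFun (introT (smooth_funP _) schi)), N; split=> //.
- apply/seteqP; split=> // y _; have [Ny|Ny] := pselect (N y); first by left.
  by right; have [z /inK[_ Uz] <-] := contrapT Ny.
- by rewrite /= /chi asboolT// gt_eqF// cube_bump_center.
Qed.
End bump.

(** * Sections that form a basis of one fibre *)

Section frame.
Context {R : realType} {n r : nat} {M : manifold R n} (V : vector_bundle M r).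

(** The coordinate sections of a trivialization, multiplied by a bump function,
    extend by zero to the whole of [M]. *)
Lemma frame_at (x : M) : exists e : 'I_r -> section V,
  forall c : 'rV[R]_r, \sum_i c ord0 i *: e i x = 0 -> c = 0.
Proof.
have [t Vt tx] := triv_cover V x.
have [chi [N [oN NU N0 chix]]] :=
  bump_function (@triv_dom_open _ _ _ _ _ t) tx.
have s_smooth (v : 'rV[R]_r) :
    smooth_section (fun y => chi y *: triv_inv t y v : V y).
  move=> u Vu; have ot := @triv_dom_open _ _ _ _ _ t.
  have ou := @triv_dom_open _ _ _ _ _ u.
  have -> : triv_dom u = (N `&` triv_dom u) `|` (triv_dom t `&` triv_dom u).
    by rewrite -setIUl NU setTI.
  apply: smooth_map_union.
    have oNu : open (N `&` triv_dom u) by exact: openI.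
    apply: smooth_map_ext (smooth_map_cst (0 : 'rV[R]_r) oNu) => // y [Ny _].
    by rewrite N0// scale0r linear0.
  have otu : open (triv_dom t `&` triv_dom u) by exact: openI.
  apply: (@smooth_map_ext _ _ _ _ _
    (fun y => chi y *: triv_map u y (triv_inv t y v))) => //.
    by move=> y _; rewrite linearZ.
  apply: smooth_mapZ => //; last exact: triv_compat.
  have /smooth_funP := smoothFunP chi.
  by apply: smooth_map_sub.
exists (fun i => Section (s_smooth (delta_mx ord0 i))) => c.
move=> /(congr1 (triv_map t x)); rewrite linear0 linear_sum/=.
under eq_bigr => i _ do
  rewrite 2!linearZ/= triv_invK// scalerA mulrC -scalerA.
rewrite -scaler_sumr -row_sum_delta => /eqP.
by rewrite scaler_eq0 (negPf chix) => /eqP.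
Qed.

End frame.

(** * Gram matrices and the section dual to a functional *)

Section gram.
Context {R : realType} {n r : nat} {M : manifold R n} {V : vector_bundle M r}.
Variable A : courant_algebroid V.
Local Notation F := (smoothFun M).

(** A name for evaluation at a point, which carries the ring morphism structure
    under which determinants can be evaluated pointwise. *)
Definition smooth_eval (y : M) (f : F) : R := f y.

Lemma smooth_eval_zmod y : zmod_morphism (smooth_eval y).
Proof. by []. Qed.
Lemma smooth_eval_monoid y : monoid_morphism (smooth_eval y).
Proof. by []. Qed.
HB.instance Definition _ y :=
  GRing.isZmodMorphism.Build F R (smooth_eval y) (smooth_eval_zmod y).
HB.instance Definition _ y :=
  GRing.isMonoidMorphism.Build F R (smooth_eval y) (smooth_eval_monoid y).

HB.instance Definition _ (y : M) (u : V y) :=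
  GRing.isLinear.Build R (V y) R *%R (fiber_form A u) (form_linear A u).

Lemma form_cochain_linear (s : section V) : scalar (form_cochain A s).
Proof. by have /asboolP[[_ +] _] := form_cocycle A; apply. Qed.
HB.instance Definition _ (s : section V) :=
  GRing.isLinear.Build F (section V) F *%R (form_cochain A s)
    (form_cochain_linear s).

Lemma form_cochainC (s s' : section V) :
  form_cochain A s s' = form_cochain A s' s.
Proof. by apply: val_inj; apply/funext => y; exact: form_sym. Qed.

Variable e : 'I_r -> section V.

Definition gram : 'M[F]_r := \matrix_(i, j) form_cochain A (e i) (e j).

(** A vector [c] in the kernel of the Gram matrix at [x] gives a combination of
    the frame that is orthogonal to the frame, hence to itself. *)
Lemma gram_det_neq0 (x : M) :
  (forall u : V x, fiber_form A u u = 0 -> u = 0) ->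
  (forall c : 'rV[R]_r, \sum_i c ord0 i *: e i x = 0 -> c = 0) ->
  (\det gram) x != 0.
Proof.
move=> anis free; have -> : (\det gram) x = \det (map_mx (smooth_eval x) gram).
  by rewrite det_map_mx.
rewrite -unitfE -unitmxE -row_free_unit; apply: inj_row_free => c cG.
apply: free; set u := \sum_i _; apply: anis.
rewrite {2}/u linear_sum/= big1// => k _; rewrite linearZ/= form_sym.
rewrite /u linear_sum/=; suff -> : \sum_i fiber_form A (e k x) (c ord0 i *: e i x) =
  (c *m map_mx (smooth_eval x) gram) ord0 k by rewrite cG mxE mulr0.
by rewrite mxE; apply: eq_bigr => i _; rewrite linearZ/= !mxE form_sym.
Qed.

(** A linear relation between the [e i y] is also one between the rows of the
    Gram matrix at [y]. *)
Lemma gram_row_free (t : local_trivialization r V) (y : M) :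
  triv_dom t y -> (\det gram) y != 0 ->
  row_free (\matrix_(i < r) triv_map t y (e i y)).
Proof.
move=> ty; have -> : (\det gram) y = \det (map_mx (smooth_eval y) gram).
  by rewrite det_map_mx.
move=> D0; apply: inj_row_free => c cE.
have Gu : map_mx (smooth_eval y) gram \in unitmx by rewrite unitmxE unitfE.
have comb0 : \sum_i c ord0 i *: e i y = 0.
  rewrite -[LHS](triv_mapK ty) linear_sum/=.
  rewrite -[RHS](triv_mapK ty) linear0; congr triv_inv.
  rewrite -[RHS]cE mulmx_sum_row; apply: eq_bigr => i _.
  by rewrite linearZ/= rowK.
apply: (can_inj (mulmxK Gu)); rewrite mul0mx; apply/rowP => k; rewrite !mxE.
rewrite -[RHS](linear0 (fiber_form A (e k y))) -comb0 linear_sum/=.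
by apply: eq_bigr => i _; rewrite linearZ/= !mxE form_sym.
Qed.

(** Where the Gram determinant does not vanish, the r independent vectors
    [e i y] span the fibre of dimension r. *)
Lemma frame_orthogonal_eq0 (y : M) (w : V y) :
  (\det gram) y != 0 -> (forall i, fiber_form A w (e i y) = 0) -> w = 0.
Proof.
move=> D0 we; have [t Vt ty] := triv_cover V y.
have := gram_row_free ty D0; rewrite row_free_unit => Eu.
apply: (form_nondegenerate (c := A)) => v.
set c := triv_map t y v *m invmx (\matrix_(i < r) triv_map t y (e i y)).
have -> : v = \sum_i c ord0 i *: e i y.
  rewrite -[LHS](triv_mapK ty) -[RHS](triv_mapK ty); congr triv_inv.
  rewrite linear_sum/= -[LHS](mulmxKV Eu) mulmx_sum_row.
  by apply: eq_bigr => i _; rewrite linearZ/= rowK.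
by rewrite linear_sum/= big1// => i _; rewrite linearZ/= we mulr0.
Qed.

(** The coordinates of [w] in the frame given by Cramer's rule, multiplied by the
    Gram determinant so that they are smooth on all of [M]. *)
Definition gram_coef (w : section V) (i : 'I_r) : F :=
  \sum_j form_cochain A w (e j) * (\adj gram) j i.

(** The section [\det gram *: w - \sum_i gram_coef w i *: e i] is orthogonal to
    the frame, so it vanishes wherever the determinant does not.  The second
    factor [\det gram] takes care of the zeros of the determinant. *)
Lemma gram_expansion (w : section V) :
  \det gram *: (\det gram *: w) = \det gram *: \sum_i gram_coef w i *: e i.
Proof.
apply/eqP; rewrite -subr_eq0 -scalerBr; apply/eqP.
set z := _ - _; apply: section_eq => y; rewrite sectionZ section0.
have [->|D0] := eqVneq ((\det gram) y) 0; first by rewrite scale0r.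
rewrite (@frame_orthogonal_eq0 y (z y)) ?scaler0// => k.
suff : form_cochain A (e k) z = 0.
  by move=> /(congr1 (smooth_eval y)); rewrite form_sym.
rewrite linearB/= linearZ/= linear_sum/=; apply/eqP; rewrite subr_eq0.
apply/eqP; under eq_bigr => i _ do rewrite linearZ/= mulr_suml.
rewrite exchange_big/=.
under eq_bigr => j _.
  under eq_bigr => i _ do rewrite -mulrA (form_cochainC (e k)).
  rewrite -mulr_sumr.
  rewrite (_ : \sum_i _ = (\adj gram *m gram) j k); last first.
    by rewrite mxE; apply: eq_bigr => i _; rewrite [gram i k]mxE.
  rewrite mul_adj_mx mxE.
  over.
rewrite (bigD1 k)//= eqxx mulr1n big1 ?addr0 => [|j /negPf jk].
  by rewrite mulrC form_cochainC.
by rewrite jk mulr0n mulr0.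
Qed.

Definition gram_dual (theta : {scalar section V}) : section V :=
  \sum_j (\sum_i (\adj gram) j i * theta (e i)) *: e j.

(** Linearity over smooth functions turns [gram_expansion] into a statement on
    [theta], without any localization of [theta]. *)
Lemma gram_dualP (theta : {scalar section V}) (w : section V) :
  \det gram * (\det gram * theta w) =
  \det gram * form_cochain A (gram_dual theta) w.
Proof.
have := congr1 theta (gram_expansion w); rewrite !linearZ/= => ->; congr (_ * _).
rewrite form_cochainC !linear_sum/=.
under eq_bigr => i _ do rewrite linearZ/= mulr_suml.
rewrite exchange_big/=; apply: eq_bigr => j _; rewrite linearZ/= mulr_suml.
by apply: eq_bigr => i _; ring.
Qed.
End gram.

Theorem theorem8p2 (R : realType) (n r : nat) (M : manifold R n)
    (V : vector_bundle M r) (A : courant_algebroid V) :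
  connected_manifold M -> (0 < r)%N ->
  cocompact_algebroid A -> definite_form A ->
  form_class A != 0.
Proof.
move=> [[x _] _] r0 _ def; apply/negP => /eqP class0.
have anis (u : V x) : fiber_form A u u = 0 -> u = 0.
  move=> u0; apply/eqP/negPn/negP => un0.
  by case: (def x) => /(_ u un0); rewrite u0 ltxx.
have [theta formE] : exists theta : {scalar section V},
    forall s s', form_cochain A s s' = theta (kv_mul A s s').
  have : Cocycle2 (form_cocycle A) \in is_coboundary2 (A := A).
    by rewrite -[X in X \in _]subr0 Quotient.idealrBE; apply/eqP; rewrite raddf0.
  move=> /asboolP[theta /(congr1 val)/= E]; exists theta => s s'.
  by rewrite E.
have [e free] := frame_at V x; have D0 := gram_det_neq0 anis free.
set h := gram_dual A e theta; set D := \det (gram A e) in D0.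
have dualP s s' : D x * (D x * form_cochain A s s' x) =
    D x * form_cochain A h (kv_mul A s s') x.
  have := congr1 (smooth_eval x) (gram_dualP A e theta (kv_mul A s s')).
  by rewrite !rmorphM -formE.
(* <h, h h> = 0 as left multiplication by h is skew. *)
have h0 : h x = 0.
  apply: anis; apply: (mulfI D0); apply: (mulfI D0); rewrite !mulr0.
  rewrite [LHS]dualP; apply/eqP; rewrite mulf_eq0; apply/orP; right.
  have := form_invariant A h h h x; rewrite form_sym -mulr2n => /eqP.
  by rewrite mulrn_eq0.
pose i := Ordinal r0.
have ei0 : e i x = 0.
  apply: anis; apply: (mulfI D0); apply: (mulfI D0); rewrite !mulr0.
  by rewrite [LHS]dualP /= h0 form_sym linear0 mulr0.
have : delta_mx ord0 i = 0 :> 'rV[R]_r.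
  apply: free; rewrite big1// => j _; rewrite mxE eqxx.
  by case: eqVneq => [->|_]; rewrite ?ei0 ?scaler0 ?scale0r.
by move=> /matrixP/(_ ord0 i)/eqP; rewrite !mxE !eqxx oner_eq0.
Qed.
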